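(* Let $\mathcal{P}$ and $\overline{\mathcal{P}}$ be disjoint finite index sets. For every $j\in\mathcal{P}\cup\overline{\mathcal{P}}$ let $g_j\in\mathbb{R}$ and $t_j>0$ be real numbers, and let $c\ge 0$. For $\mathcal{M}\subseteq\mathcal{P}\cup\overline{\mathcal{P}}$ put $\Delta(\mathcal{M}):=\sum_{j\in\mathcal{M}}g_j^2$, $T(\mathcal{M}):=c+\sum_{j\in\mathcal{M}}t_j$ and $\Gamma(\mathcal{M}):=\Delta(\mathcal{M})/T(\mathcal{M})$, and assume $T(\overline{\mathcal{P}})>0$. Let $\mathcal{A}\subseteq\mathcal{P}$ be the output of the greedy algorithm described in the context. Then for every subset $\mathcal{A}'\subseteq\mathcal{P}$ with $\mathcal{A}'\neq\mathcal{A}$, $$\Gamma(\mathcal{A}\cup\overline{\mathcal{P}})\;\ge\;\Gamma(\mathcal{A}'\cup\overline{\mathcal{P}}).$$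
   Context: Greedy algorithm (input: the numbers $g_j^2$ and $t_j$ for all indices $j$, and $c$; output: a set $\mathcal{A}\subseteq\mathcal{P}$). Start with $\mathcal{A}=\emptyset$. Sort the indices $j\in\mathcal{P}$ in non-increasing order of the ratio $g_j^2/t_j$ (ties broken arbitrarily). Go through the indices $j$ in this order: if $g_j^2/t_j\ge\Gamma(\mathcal{A}\cup\overline{\mathcal{P}})$ for the current set $\mathcal{A}$, replace $\mathcal{A}$ by $\mathcal{A}\cup\{j\}$ and continue with the next index; otherwise stop. When the loop stops or all indices have been processed, return the current $\mathcal{A}$. *)

(* Defs.v *)
From mathcomp Require Import all_boot all_order all_algebra.

Set Implicit Arguments.
Unset Strict Implicit.
Unset Printing Implicit Defensive.

Import Order.TTheory GRing.Theory Num.Theory.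
Local Open Scope ring_scope.

(* The index sets P and Pbar are disjoint finite sets inside a finite type I;
   g and t are total functions on I, of which only the values on P and Pbar
   matter. *)

Definition Delta (R : realFieldType) (I : finType) (g : I -> R)
    (M : {set I}) : R :=
  \sum_(j in M) g j ^+ 2.

Definition Ttot (R : realFieldType) (I : finType) (t : I -> R) (c : R)
    (M : {set I}) : R :=
  c + \sum_(j in M) t j.

Definition Gamma (R : realFieldType) (I : finType) (g t : I -> R) (c : R)
    (M : {set I}) : R :=
  Delta g M / Ttot t c M.

Definition ratio (R : realFieldType) (I : finType) (g t : I -> R) (j : I) : R :=
  g j ^+ 2 / t j.

(* Ties may be broken arbitrarily, so P has in general several such
   enumerations. *)
Definition greedy_order (R : realFieldType) (I : finType) (g t : I -> R)
    (P : {set I}) (s : seq I) : Prop :=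
  [/\ uniq s, s =i P & sorted (fun i j => ratio g t j <= ratio g t i) s].

Fixpoint greedy_loop (R : realFieldType) (I : finType) (g t : I -> R) (c : R)
    (Pbar : {set I}) (s : seq I) (A : {set I}) : {set I} :=
  if s is j :: s' then
    if Gamma g t c (A :|: Pbar) <= ratio g t j
    then greedy_loop g t c Pbar s' (A :|: [set j])
    else A
  else A.

(* A is the set returned by a run of the greedy algorithm, for some way of
   breaking the ties. *)
Definition greedy_output (R : realFieldType) (I : finType) (g t : I -> R)
    (c : R) (P Pbar A : {set I}) : Prop :=
  exists2 s : seq I, greedy_order g t P s & A = greedy_loop g t c Pbar s set0.

(* Main.v *)
(* The output A is a threshold set: with gamma = Gamma (A :|: Pbar), the indices
   of A have ratio >= gamma and those of P :\: A have ratio <= gamma. Hence A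
   maximises the linearised objective Delta (M :|: Pbar) - gamma * T (M :|: Pbar)
   over the subsets M of P, and its maximum is 0 by the choice of gamma. *)
Require Import Defs.
From mathcomp Require Import all_boot all_order all_algebra.

Import Order.TTheory GRing.Theory Num.Theory.
Local Open Scope ring_scope.

(* all_algebra also exports a [ratio], from fraction.v. *)
Local Notation ratio := Defs.ratio.

Lemma sum_disjointU {V : nmodType} {I : finType} (f : I -> V) {A B : {set I}} :
  [disjoint A & B] ->
  \sum_(j in A :|: B) f j = \sum_(j in A) f j + \sum_(j in B) f j.
Proof. by move=> dAB; rewrite -bigU //; apply: eq_bigl => j; rewrite !inE. Qed.

Lemma Ttot_setU_gt0 {R : realFieldType} {I : finType} {t : I -> R} {c : R}
    {A B : {set I}} :
  [disjoint A & B] -> (forall j, j \in A -> 0 < t j) -> 0 < Ttot t c B ->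
  0 < Ttot t c (A :|: B).
Proof.
move=> disjAB t_gt0 T_gt0; rewrite /Ttot (sum_disjointU t disjAB) addrCA.
by apply: ltr_wpDl T_gt0; apply: sumr_ge0 => j /t_gt0/ltW.
Qed.

(* Half of the mediant inequality, Gamma (j |: M) being the mediant of Gamma M
   and g j ^+ 2 / t j. *)
Lemma Gamma_setU1_le_ratio {R : realFieldType} {I : finType} {g t : I -> R}
    {c : R} {M : {set I}} {j : I} :
  j \notin M -> 0 < t j -> 0 < Ttot t c M ->
  Gamma g t c M <= ratio g t j -> Gamma g t c (j |: M) <= ratio g t j.
Proof.
move=> jM tj_gt0 T_gt0.
have TU : Ttot t c (j |: M) = t j + Ttot t c M.
  by rewrite /Ttot big_setU1 //= addrCA.
have TU_gt0 : 0 < Ttot t c (j |: M) by rewrite TU addr_gt0.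
rewrite /Gamma !ler_pdivrMr // TU (mulrDr _ (t j)) /ratio divfK ?gt_eqF //.
by rewrite /Delta big_setU1 //= lerD2l.
Qed.

Lemma subset_greedy_loop {R : realFieldType} {I : finType} (g t : I -> R)
    (c : R) (Pbar : {set I}) (s : seq I) (A : {set I}) :
  A \subset greedy_loop g t c Pbar s A.
Proof.
elim: s A => //= j s IHs A; case: ifP => // _.
exact: subset_trans (subsetUl _ _) (IHs _).
Qed.

(** The last two hypotheses form the loop invariant, vacuous at [set0]; the induction on [s] carries
    it for an arbitrary current set [A]. *)
Lemma greedy_loop_threshold {R : realFieldType} {I : finType} (g t : I -> R)
    (c : R) (Pbar : {set I}) (s : seq I) (A : {set I}) :
    let r := ratio g t in let B := greedy_loop g t c Pbar s A in
    uniq s -> sorted (fun i j => r j <= r i) s ->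
    (forall j, j \in s -> [/\ j \notin A, j \notin Pbar & 0 < t j]) ->
    0 < Ttot t c (A :|: Pbar) ->
    (forall i j, i \in A -> j \in s -> r j <= r i) ->
    (forall i, i \in A -> Gamma g t c (A :|: Pbar) <= r i) ->
  [/\ forall i, i \in B -> (i \in A) || (i \in s),
      forall i, i \in B -> Gamma g t c (B :|: Pbar) <= r i
    & forall i, i \in s -> i \notin B -> r i <= Gamma g t c (B :|: Pbar)].
Proof.
move=> r; elim: s A => [|j s IHs] A /=; first by split=> // i ->.
move=> /andP[js uniq_s] sorted_js fresh T_gt0 leA GammaA.
have le_tr : transitive (fun i k => r k <= r i).
  by move=> y x z /[swap]; apply: le_trans.
have le_j i : i \in s -> r i <= r j.
  by move=> i_s; apply: (allP (order_path_min le_tr sorted_js)).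
have [jA jPbar tj_gt0] := fresh j (mem_head _ _).
have jU : j \notin A :|: Pbar by rewrite inE negb_or jA.
(* If the loop stops at [j], then [B] is [A], and sortedness puts every later ratio below that of
   [j], hence below Gamma. *)
case: ifP => [Gamma_j | /negbT]; last first.
  rewrite -ltNge => /ltW r_j; split=> // [i -> // | i].
  by rewrite inE => /predU1P[-> // | /le_j r_i _]; apply: le_trans r_j.
have UE : A :|: [set j] :|: Pbar = j |: (A :|: Pbar).
  by rewrite (setUC A) -setUA.
case: (IHs (A :|: [set j])) => //.
- exact: path_sorted sorted_js.
- move=> i i_s; have [|iA iPbar ti] := fresh i; first by rewrite inE i_s orbT.
  split=> //; rewrite !inE negb_or iA /=.
  by apply: contraNneq js => <-.
- rewrite UE /Ttot big_setU1 //= addrCA; exact: addr_gt0.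
- move=> i k; rewrite !inE => /orP[iA | /eqP->] k_s; last exact: le_j.
  by apply: leA => //; rewrite inE k_s orbT.
(* Accepting [j] may raise Gamma, but not above [r j], which is the smallest ratio in the enlarged
   set. *)
- have Gamma'_j := Gamma_setU1_le_ratio jU tj_gt0 T_gt0 Gamma_j.
  move=> i; rewrite UE !inE => /orP[iA | /eqP-> //].
  by apply: le_trans Gamma'_j _; apply: leA; rewrite ?mem_head.
move=> subB geB leB; split=> // i.
  by move/subB; rewrite !inE orbA.
(* The loop never discards an accepted index, so [j] cannot lie outside the output. *)
rewrite inE => /predU1P[-> jB | ]; last exact: leB.
case/negP: jB; apply: (subsetP (subset_greedy_loop _ _ _ _ _ _)).
by rewrite !inE eqxx orbT.
Qed.

(** The terms over the intersection cancel; what remains is nonpositive for [B] and nonnegative for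
    [A]. *)
Lemma sum_le_sum_nonneg_part {R : realFieldType} {I : finType} {f : I -> R}
    {A B : {set I}} :
  (forall j, j \in A -> 0 <= f j) -> (forall j, j \in B :\: A -> f j <= 0) ->
  \sum_(j in B) f j <= \sum_(j in A) f j.
Proof.
move=> f_ge0 f_le0.
rewrite (big_setID A) [leRHS](big_setID B) /= setIC lerD2l.
apply: (@le_trans _ _ 0); first exact: sumr_le0.
by apply: sumr_ge0 => j /setDP[/f_ge0].
Qed.

Theorem theorem1 (R : realFieldType) (I : finType) (P Pbar : {set I})
    (g t : I -> R) (c : R)
    (disjP : [disjoint P & Pbar])
    (t_gt0 : forall j, j \in P :|: Pbar -> 0 < t j)
    (c_ge0 : 0 <= c)
    (T_gt0 : 0 < Ttot t c Pbar)
    (A : {set I}) (HA : greedy_output g t c P Pbar A)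
    (A' : {set I}) (sA'P : A' \subset P) (neqA : A' <> A) :
  Gamma g t c (A :|: Pbar) >= Gamma g t c (A' :|: Pbar).
Proof.
have tP j : j \in P -> 0 < t j by move=> jP; apply: t_gt0; rewrite inE jP.
case: HA => s [uniq_s sP sorted_s] defA.
have [] := greedy_loop_threshold g t c Pbar s set0 uniq_s sorted_s.
- move=> j; rewrite sP => jP; rewrite inE tP //.
  by rewrite (disjointFr disjP jP).
- by rewrite set0U.
- by move=> i j; rewrite inE.
- by move=> i; rewrite inE.
rewrite -defA => subA geA leA.
have sAP : A \subset P by apply/subsetP => i /subA; rewrite inE sP.
have TU_gt0 (M : {set I}) : M \subset P -> 0 < Ttot t c (M :|: Pbar).
  move=> sMP; apply: Ttot_setU_gt0 T_gt0; first exact: disjointWl sMP disjP.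
  by move=> j /(subsetP sMP)/tP.
set y := Gamma g t c (A :|: Pbar) in geA leA *.
(* The contribution of [j] to the linearised objective; as [t j] is positive on [P], its sign there
   is that of [ratio g t j - y]. *)
pose f j := g j ^+ 2 - y * t j.
(* The terms from [Pbar] and [c] are the same for every [M], so only the sums of [f] over [M] have
   to be compared. *)
have excess (M : {set I}) : M \subset P ->
    Delta g (M :|: Pbar) - y * Ttot t c (M :|: Pbar)
    = \sum_(j in M) f j + (\sum_(j in Pbar) f j - y * c).
  move=> sMP; rewrite addrA -sum_disjointU; last exact: disjointWl sMP disjP.
  rewrite /f sumrB -mulr_sumr /Delta /Ttot mulrDr opprD.
  by rewrite (addrC (- (y * c))) addrA.
have excessA : Delta g (A :|: Pbar) - y * Ttot t c (A :|: Pbar) = 0.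
  by rewrite /y /Gamma divfK ?subrr // gt_eqF // TU_gt0.
(* The claim says that the excess of [A'] is at most 0; writing this 0 as the excess of [A] lets the
   common constant cancel. *)
rewrite {1}/Gamma ler_pdivrMr ?TU_gt0 // -subr_le0 -excessA !excess // lerD2r.
apply: sum_le_sum_nonneg_part => j.
  move=> jA; rewrite subr_ge0 -ler_pdivlMr; first exact: geA.
  exact: tP (subsetP sAP j jA).
case/setDP => /(subsetP sA'P) jP jA.
by rewrite subr_le0 -ler_pdivrMr ?tP //; apply: leA; rewrite ?sP.
Qed.
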